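(* Let $k\ge 1$ be an integer and consider the game $\Gamma'_k([0,1])$ played on the line segment $[0,1]$. An optimal strategy for the attacker is to divide (partition) $[0,1]$ into $2k$ pairwise disjoint subintervals each of length $1/(2k)$, and choose one of these subintervals uniformly at random. An optimal strategy for the defender is to select a number $u$ uniformly at random in $(0,1/k)$ and place the $k$ booby traps at $u,\ u+1/k,\ u+2/k,\ \ldots,\ u+(k-1)/k$. The value of the game is $1/(4k)$.
   Context: The game $\Gamma'_k([0,1])$ is the following zero-sum game. Let $\lambda$ be Lebesgue measure on $[0,1]$. The defender chooses $k$ distinct points of $[0,1]$ (the booby traps). The attacker chooses a connected subset $S$ of $[0,1]$ (an interval). The players choose without knowing each other's choice. The payoff to the attacker is $\lambda(S)$ if $S$ contains no booby trap, and $0$ otherwise; the attacker maximizes and the defender minimizes the expected payoff. Mixed strategies are random choices of pure strategies (such that the payoff against each opposing pure strategy is measurable). The game has value $V$ if for every $\varepsilon>0$ the attacker has a mixed strategy with expected payoff at least $V-\varepsilon$ against every pure strategy of the defender, and the defender has a mixed strategy with expected payoff at most $V+\varepsilon$ against every pure strategy of the attacker. A mixed strategy of the defender (attacker) is optimal if it guarantees expected payoff at most (at least) $V$ against every opposing pure strategy. *)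

(* Defs.v *)
From HB Require Import structures.
From mathcomp Require Import all_boot all_order all_algebra.
From mathcomp Require Import all_classical all_reals all_analysis.
From mathcomp Require Import measurable_realfun.

Set Implicit Arguments.
Unset Strict Implicit.
Unset Printing Implicit Defensive.
Import Order.TTheory GRing.Theory Num.Theory numFieldNormedType.Exports.
Local Open Scope classical_set_scope.
Local Open Scope card_scope.
Local Open Scope ring_scope.

Section Game.
Context (R : realType).
Implicit Types (S B : set R) (k : nat) (V : R).

Definition attacker_pure S : Prop := S `<=` `[0, 1] /\ connected S.

Definition defender_pure k B : Prop := B `<=` `[0, 1] /\ B #= `I_k.

Definition payoff S B : \bar R :=
  (if `[< S `&` B = set0 >] then lebesgue_measure S else 0)%E.

(* There is no sigma-algebra on pure strategies: a random choice is a function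
   on a probability space, and mixed strategies only ask for the payoff against
   each opposing pure strategy to be measurable. *)
Record random_choice (T : Type) := RandomChoice {
  disp : measure_display;
  sample : measurableType disp;
  law : probability sample R;
  draw : sample -> T }.

Arguments draw {T} r _.
Implicit Types s : random_choice (set R).

Definition attacker_mixed k s : Prop :=
  (forall w, attacker_pure (draw s w)) /\
  (forall B, defender_pure k B ->
     measurable_fun setT (fun w => payoff (draw s w) B)).

Definition defender_mixed k s : Prop :=
  (forall w, defender_pure k (draw s w)) /\
  (forall S, attacker_pure S ->
     measurable_fun setT (fun w => payoff S (draw s w))).

Definition attacker_guarantees k s V : Prop :=
  attacker_mixed k s /\
  (forall B, defender_pure k B ->
     (V%:E <= \int[law s]_w payoff (draw s w) B)%E).

Definition defender_guarantees k s V : Prop :=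
  defender_mixed k s /\
  (forall S, attacker_pure S ->
     (\int[law s]_w payoff S (draw s w) <= V%:E)%E).

Definition game_value k V : Prop :=
  forall eps : R, 0 < eps ->
    (exists s, attacker_guarantees k s (V - eps)) /\
    (exists s, defender_guarantees k s (V + eps)).

Definition attacker_optimal k s : Prop :=
  exists2 V, game_value k V & attacker_guarantees k s V.

Definition defender_optimal k s : Prop :=
  exists2 V, game_value k V & defender_guarantees k s V.

Definition equal_subintervals n (I : 'I_n -> set R) : Prop :=
  [/\ forall i, is_interval (I i),
      trivIset setT I,
      \bigcup_i I i = `[0, 1]%classic &
      forall i, lebesgue_measure (I i) = (n%:R^-1)%:E].

Definition uniform_choice n (I : 'I_n -> set R) s : Prop :=
  exists J : sample s -> 'I_n,
    [/\ forall i, measurable (J @^-1` [set i]),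
        forall i, law s (J @^-1` [set i]) = (n%:R^-1)%:E &
        forall w, draw s w = I (J w)].

Definition traps k (u : R) : set R :=
  [set u + j%:R / k%:R | j in `I_k].

Lemma invk_gt0 k : (0 < k)%N -> 0 < k%:R^-1 :> R.
Proof. by move=> k0; rewrite invr_gt0 ltr0n. Qed.

(* Equality with [uniform_prob] is required on measurable sets only, because
   both sides are also defined, without meaning, on the other sets. *)
Definition uniform_traps k (hk : (0 < k)%N) s : Prop :=
  exists U : {RV law s >-> R},
    [/\ forall A, measurable A ->
          distribution (law s) U A = uniform_prob (invk_gt0 hk) A,
        forall w, U w \in `]0, k%:R^-1[ &
        forall w, draw s w = traps k (U w)].

End Game.

(* Main.v *)
Require Import Defs.
From HB Require Import structures.
From mathcomp Require Import all_boot all_order all_algebra.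
From mathcomp Require Import all_classical all_reals all_analysis.
From mathcomp Require Import measurable_realfun.
From mathcomp Require Import ring lra.

Set Implicit Arguments.
Unset Strict Implicit.
Unset Printing Implicit Defensive.
Import Order.TTheory GRing.Theory Num.Theory numFieldNormedType.Exports.
Local Open Scope classical_set_scope.
Local Open Scope ring_scope.

(** A set of [k] traps meets at most [k] of the [2k] disjoint pieces, so a
    uniformly chosen piece escapes with probability at least [1/2] and earns
    [1/(4k)]. Conversely, let [S] have length [L]. The expected number of points
    [u + j/k] in [S] is [k L], and at most one can lie in an open interval of
    length at most [1/k]; so [S] is hit with probability [min (1, k L)], and
    [L (1 - min (1, k L)) <= 1/(4k)]. *)

(** * Lengths of intervals and the uniform law *)

Section Intervals.
Context {R : realType}.
Local Notation mu := (@lebesgue_measure R).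

(** By monotonicity on both sides; this makes it irrelevant which endpoints [T] contains. *)
Lemma lebesgue_measure_sandwich (c d : R) (T : set R) : c <= d ->
  measurable T -> `]c, d[ `<=` T -> T `<=` `[c, d] -> mu T = (d - c)%:E.
Proof.
move=> cd mT cdT Tcd; apply/eqP; rewrite eq_le; apply/andP; split.
- apply: (@le_trans _ _ (mu `[c, d])); first by apply: le_measure; rewrite ?inE//=.
  rewrite lebesgue_measure_itv/= lte_fin.
  by case: ltP => // dc; rewrite lee_fin subr_ge0.
- apply: (@le_trans _ _ (mu `]c, d[)); last by apply: le_measure; rewrite ?inE//=.
  rewrite lebesgue_measure_itv/= lte_fin.
  by case: ltP => // dc; rewrite lee_fin subr_le0.
Qed.

(** Take [a = inf S] and [b = sup S]; the empty set is treated apart, with [a = b = 0]. *)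
Lemma is_interval_core (S : set R) : S `<=` `[0, 1] -> is_interval S ->
  exists a b : R,
    [/\ 0 <= a, a <= b, b <= 1, `]a, b[ `<=` S & mu S = (b - a)%:E].
Proof.
move=> S01 iS; have [->|/set0P[x Sx]] := eqVneq S set0.
  exists 0, 0; split => //; rewrite ?measure0 ?subrr// => x /=.
  by rewrite in_itv/= => /andP[/lt_trans h /h]; rewrite ltxx.
have lS : lbound S 0 by move=> y /S01 /=; rewrite in_itv/= => /andP[].
have uS : ubound S 1 by move=> y /S01 /=; rewrite in_itv/= => /andP[].
have hlS : has_lbound S by exists 0.
have huS : has_ubound S by exists 1.
have infx : inf S <= x by exact: ge_inf.
have xsup : x <= sup S by exact: ub_le_sup.
have inS : `]inf S, sup S[ `<=` S.
  apply: subset_trans (@interior_subset _ S).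
  by rewrite interval_bounded_interior// => y /=; rewrite in_itv.
exists (inf S), (sup S); split => //.
- by apply: lb_le_inf => //; exists x.
- exact: le_trans xsup.
- by apply: ge_sup => //; exists x.
- apply: lebesgue_measure_sandwich => //; first exact: le_trans xsup.
  + exact: is_interval_measurable.
  + by move=> y Sy /=; rewrite in_itv/= ge_inf//= ub_le_sup.
Qed.

(** The two sets differ at most by the null set of endpoints [c] and [d]. *)
Lemma lebesgue_measure_setI_itvoo (c d : R) (A : set R) : measurable A ->
  mu (A `&` `]c, d[) = mu (A `&` `[c, d]).
Proof.
move=> mA; apply/eqP; rewrite eq_le; apply/andP; split.
  apply: le_measure; rewrite ?inE; [exact: measurableI.. |].
  by apply: setIS; exact: subset_itv_oo_cc.
apply: (@le_trans _ _ (mu ((A `&` `]c, d[) `|` ([set c] `|` [set d])))).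
  apply: le_measure; rewrite ?inE; [exact: measurableI | |].
    by apply: measurableU; [exact: measurableI | exact: measurableU].
  move=> x [Ax]; rewrite /= in_itv/= => /andP[cx xd].
  have [->|xc] := eqVneq x c; first by right; left.
  have [->|xd'] := eqVneq x d; first by right; right.
  by left; split => //=; rewrite in_itv/= !lt_neqAle cx xd xd' eq_sym xc.
have m2 : measurable ([set c] `|` [set d] : set R) by exact: measurableU.
apply: le_trans; first by apply: measureU2 => //; exact: measurableI.
rewrite -[leRHS]adde0 leeD2l//.
apply: le_trans; first exact: measureU2.
rewrite [X in (X + _)%E]lebesgue_measure_set1.
by rewrite [X in (_ + X)%E]lebesgue_measure_set1 adde0.
Qed.

(* [clamp a b d - clamp a b c] is the length of [`]a, b[ `&` `[c, d]]; in this
   form the lengths over consecutive cells telescope. *)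
Definition clamp (a b t : R) : R := Num.max a (Num.min t b).

Lemma clamp_cases (a b t : R) : a <= b ->
  [\/ t <= a /\ clamp a b t = a, a <= t <= b /\ clamp a b t = t |
      b <= t /\ clamp a b t = b].
Proof.
move=> ab; rewrite /clamp; have [tb|/ltW bt] := leP t b; last first.
  by rewrite max_r//; constructor 3.
have [?|?] := leP t a; first by constructor 1.
by constructor 2; split => //; rewrite ltW.
Qed.

Lemma lebesgue_measure_shifted_itv (a b s r : R) : a <= b -> 0 <= r ->
  mu ([set u | u + s \in `]a, b[] `&` `[0, r]) =
  (clamp a b (s + r) - clamp a b s)%:E.
Proof.
move=> ab r0.
(* Shifting back by [s] turns the clamped values into the endpoints of the intersection. *)
have -> : clamp a b (s + r) - clamp a b s =
    (clamp a b (s + r) - s) - (clamp a b s - s) by lra.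
have E : [set u | u + s \in `]a, b[] = `]a - s, b - s[%classic :> set R.
  by apply/seteqP; split => u /=; rewrite !in_itv/= ltrBlDr ltrBrDr.
have [c d] := (clamp_cases s ab, clamp_cases (s + r) ab).
rewrite E; apply: lebesgue_measure_sandwich.
- by case: c => -[] ? ->; case: d => -[] ? ->; lra.
- exact: measurableI.
- move=> u /=; rewrite !in_itv/= => /andP[].
  by case: c => -[] ? ->; case: d => -[] ? -> ? ?; split; apply/andP; split; lra.
- move=> u /=; rewrite !in_itv/= => -[/andP[? ?] /andP[? ?]].
  by case: c => -[] ? ->; case: d => -[] ? ->; apply/andP; split; lra.
Qed.

(** The density is the constant [1/r] on [[0, r]], so probabilities become lengths. *)
Lemma uniform_prob_restrict (r : R) (r0 : 0 < r) (A : set R) : measurable A ->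
  uniform_prob r0 A = ((r^-1)%:E * mu (A `&` [set` `[0%R, r]]))%E.
Proof.
move=> mA; rewrite /uniform_prob integral_uniform_pdf.
rewrite -integral_cst; last exact: measurableI.
apply: eq_integral => x; rewrite inE => -[_ /=]; rewrite in_itv/= => x0r.
by rewrite /uniform_pdf x0r subr0.
Qed.

End Intervals.

Lemma traps_defender_pure (R : realType) (k : nat) (u : R) : (0 < k)%N ->
  u \in `]0, k%:R^-1[ -> defender_pure k (traps k u).
Proof.
move=> k0; rewrite in_itv/= => /andP[u0 uk]; have k0' := invk_gt0 R k0; split.
  move=> _ [j /= jk <-]; rewrite in_itv/=; apply/andP; split.
    by apply: addr_ge0; [exact: ltW | exact: divr_ge0].
  apply: (@le_trans _ _ (k%:R^-1 + j%:R / k%:R)); first by rewrite lerD2r ltW.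
  rewrite -[X in X + _]mul1r -mulrDl ler_pdivrMr ?ltr0n// mul1r.
  by rewrite addrC natr1 ler_nat.
rewrite card_eq_sym; apply/card_set_bijP; exists (fun j => u + j%:R / k%:R).
split => //; first by move=> j jk; exists j.
move=> i j _ _ /addrI /mulIf; rewrite gt_eqF// => /(_ isT) /eqP.
by rewrite eqr_nat => /eqP.
Qed.

(** * Expected payoff when the attacker's set has constant length *)

Section PayoffIntegral.
Context {R : realType} {d : measure_display} {T : measurableType d}.
Context (S B : T -> set R) (L : R) (L0 : 0 <= L).
Context (muS : forall w, lebesgue_measure (S w) = L%:E).
Let escape := [set w | S w `&` B w = set0].

Lemma payoff_indic w : payoff (S w) (B w) = (L * \1_escape w)%:E.
Proof.
rewrite /payoff indicE; case: asboolP => h.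
  by rewrite mem_set// mulr1 muS.
by rewrite memNset// mulr0.
Qed.

Lemma measurable_payoff : measurable escape ->
  measurable_fun setT (fun w => payoff (S w) (B w)).
Proof.
move=> mE; rewrite (_ : (fun w => _) = EFin \o (fun w => L * \1_escape w)).
  by apply/measurable_EFinP; apply: measurable_funM => //; exact: measurable_indic.
by apply/funext => w; rewrite payoff_indic.
Qed.

(** Serves both players: [B] is constant against a random piece, [S] is constant against random
    traps. *)
Lemma integral_payoff (P : probability T R) : measurable escape ->
  (\int[P]_w payoff (S w) (B w) = L%:E * P escape)%E.
Proof.
move=> mE; under eq_integral do rewrite payoff_indic.
rewrite (integralZl_indic measurableT (fun=> escape))//.
  by rewrite integral_indic// setIT.
by move=> /lt_geF; rewrite L0.
Qed.

End PayoffIntegral.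

(** * The defender's randomly shifted traps *)

Section Defender.
Context {R : realType} (k : nat) (k0 : (0 < k)%N).
Let kgt0 : 0 < k%:R :> R. Proof. by rewrite ltr0n. Qed.

(** A set of offsets [u] on the whole line; the uniform law restricts it to [[0, 1/k]]. *)
Definition hit (S : set R) : set R := [set u | traps k u `&` S !=set0].

Lemma hitE (S : set R) :
  hit S = \bigcup_(j in `I_k) [set u | S (u + j%:R / k%:R)].
Proof.
apply/seteqP; split => [u [_ [[j jk <-] Sj]]|u [j jk Sj]]; first by exists j.
by exists (u + j%:R / k%:R); split => //; exists j.
Qed.

Lemma measurable_shift (S : set R) s : measurable S ->
  measurable [set u : R | S (u + s)].
Proof.
move=> mS; rewrite -[X in measurable X]setTI.
by apply: (measurable_funD (@measurable_id _ _ _) (@measurable_cst _ _ _ _ _ s)).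
Qed.

Lemma measurable_hit (S : set R) : measurable S -> measurable (hit S).
Proof.
move=> mS; rewrite hitE; apply: bigcup_measurable => j _.
exact: measurable_shift.
Qed.

(** The events that trap [j] lies in []a, b[] are disjoint, and each has probability [k] times the
    length of []a, b[] inside the cell [[j/k, (j+1)/k]]. The cells tile [[0, 1]]. *)
Lemma uniform_prob_hit_itv (a b : R) : 0 <= a -> a <= b -> b <= 1 ->
  b - a <= k%:R^-1 ->
  uniform_prob (invk_gt0 R k0) (hit `]a, b[) = (k%:R * (b - a))%:E.
Proof.
move=> a0 ab b1 bak; rewrite hitE.
pose A (j : nat) : set R := [set u | `]a, b[%classic (u + j%:R / k%:R)].
have mA j : measurable (A j) by exact: measurable_shift.
have tA : trivIset setT A.
  apply/trivIsetP => i j _ _ ij; apply/seteqP; split => // u []; rewrite /A /=.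
  rewrite !in_itv/= => /andP[a1 b2] /andP[a2 b3]; apply/negP: ij; apply/negPn.
  (* Two traps in []a, b[] satisfy [(n - m)/k < b - a <= 1/k], hence [n < m + 1]; by symmetry the
     indices agree. *)
  suff h (m n : nat) : a < u + m%:R / k%:R -> u + n%:R / k%:R < b -> (n <= m)%N.
    by rewrite eqn_leq !h.
  move=> am nb; rewrite -ltnS -(ltr_nat R) -(ltr_pM2r (invk_gt0 R k0)).
  by rewrite -natr1 mulrDl mul1r; lra.
have -> := @measure_fin_bigcup _ _ _ (uniform_prob (invk_gt0 R k0)) _ `I_k A
  (finite_II k) (sub_trivIset (@subsetT _ _) tA) (fun j _ => mA j).
rewrite -fsbig_ord.
transitivity (\sum_(j < k) (k%:R * (clamp a b (j.+1%:R / k%:R) -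
    clamp a b (j%:R / k%:R)))%:E)%E.
  apply: eq_bigr => j _; rewrite [LHS]uniform_prob_restrict /=; last exact: mA.
  rewrite invrK lebesgue_measure_shifted_itv//.
  by rewrite -EFinM -natr1 mulrDl mul1r.
rewrite sumEFin -mulr_sumr; congr (_ * _)%:E.
rewrite -(big_mkord xpredT
  (fun j => clamp a b (j.+1%:R / k%:R) - clamp a b (j%:R / k%:R))).
(* What remains is the clamp at [1] minus the clamp at [0], which is [b - a] because [0 <= a] and
   [b <= 1]. *)
rewrite telescope_sumr// divff ?gt_eqF// mul0r.
by case: (clamp_cases 0 ab) (clamp_cases 1 ab) => -[] ? -> [] [] ? ->; lra.
Qed.

(** A set of length [x <= 1/k] is hit with probability at least [k x], a longer one almost surely.
    Lengths and probabilities are returned as reals so that the final inequality is real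
    arithmetic. *)
Lemma uniform_prob_hit_bound (S : set R) : attacker_pure S ->
  exists a b p : R, [/\ a <= b, lebesgue_measure S = (b - a)%:E,
    uniform_prob (invk_gt0 R k0) (hit S) = p%:E &
    (b - a) * (1 - p) <= (4 * k%:R)^-1].
Proof.
move=> [S01 /connected_intervalP iS].
have [a [b [a0 ab b1 abS muS]]] := is_interval_core S01 iS.
have mH := measurable_hit (is_interval_measurable iS).
pose P : probability _ R := uniform_prob (invk_gt0 R k0).
have PHfin : P (hit S) \is a fin_num by exact: fin_num_measure.
have rk : 0 < k%:R^-1 :> R := invk_gt0 R k0.
(* Truncating to [`]a, c[] makes the events of being hit by different traps
   disjoint. *)
set c := Num.min b (a + k%:R^-1).
have [ac cb cak] : [/\ a <= c, c <= b & c - a <= k%:R^-1].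
  by rewrite /c; case: (leP b (a + k%:R^-1)) => ?; split; lra.
have hp : k%:R * (c - a) <= fine (P (hit S)).
  rewrite -lee_fin fineK// -uniform_prob_hit_itv//; last exact: le_trans cb b1.
  apply: le_measure; rewrite ?inE//; first exact: measurable_hit.
  move=> u [x [xu xac]]; exists x; split => //; apply: abS.
  by move: xac; rewrite /= !in_itv/= => /andP[-> /lt_le_trans ->].
have p1 : fine (P (hit S)) <= 1 by rewrite -lee_fin fineK// probability_le1.
exists a, b, (fine (P (hit S))); split => //; first by rewrite fineK.
set p := fine _ in hp p1 *.
have [bak|] := leP b (a + k%:R^-1).
  have cE : c = b by rewrite /c min_l.
  rewrite cE in hp; apply: (@le_trans _ _ ((b - a) * (1 - k%:R * (b - a)))).
    by apply: ler_wpM2l; lra.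
  rewrite -[leRHS]div1r ler_pdivlMr ?mulr_gt0//.
  (* With [x = b - a], the bound [4 k x (1 - k x) <= 1] is [(2 k x - 1)^2 >= 0]. *)
  by have := sqr_ge0 (2 * k%:R * (b - a) - 1); nra.
move=> /ltW akb; have cE : c = a + k%:R^-1 by rewrite /c min_r.
move: hp; rewrite cE addrAC subrr add0r divff ?gt_eqF// => hp.
(* The truncated interval has length exactly [1/k], so [hp] reads [1 <= p]. *)
have -> : p = 1 by lra.
by rewrite subrr mulr0 invr_ge0 mulr_ge0.
Qed.

Lemma uniform_traps_guarantees (s : random_choice R (set R)) :
  uniform_traps k0 s -> defender_guarantees k s (4 * k%:R)^-1.
Proof.
move=> [U [UP U0k sU]].
have escapeE S : [set w : sample s | S `&` draw w = set0] = U @^-1` (~` hit S).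
  apply/seteqP; split => w /=; rewrite sU setIC.
    by move=> h [x]; rewrite h.
  by move=> /nonemptyPn.
have mesc S : measurable S -> measurable [set w : sample s | S `&` draw w = set0].
  move=> mS; rewrite escapeE -[X in measurable X]setTI.
  by apply: measurable_funPT => //; apply: measurableC; exact: measurable_hit.
split; first split => [w|S pS].
- by rewrite sU; exact: traps_defender_pure.
- have mS : measurable S by case: pS => _ /connected_intervalP /is_interval_measurable.
  have [a [b [p [ab muS _ _]]]] := uniform_prob_hit_bound pS.
  by apply: (measurable_payoff (S := fun=> S) (fun=> muS)); exact: mesc.
- move=> S pS.
  have mS : measurable S by case: pS => _ /connected_intervalP /is_interval_measurable.
  have [a [b [p [ab muS hitp le]]]] := uniform_prob_hit_bound pS.
  have ba0 : 0 <= b - a by rewrite subr_ge0.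
  rewrite (integral_payoff ba0 (fun=> muS)); last exact: mesc.
  rewrite escapeE.
  have mH := measurable_hit mS.
  (* The law of [U] transfers the escape event to the complement of [hit S]. *)
  have -> : law s (U @^-1` (~` hit S)) = (1 - p)%:E.
    rewrite -[LHS]/(distribution (law s) U (~` hit S)) UP; last exact: measurableC.
    by rewrite probability_setC// EFinB -hitp.
  by rewrite -EFinM lee_fin.
Qed.

Lemma exists_uniform_traps : exists s : random_choice R (set R), uniform_traps k0 s.
Proof.
have kR := invk_gt0 R k0.
pose P : probability _ R := uniform_prob kR.
(* [uniform_traps] requires [U w \in `]0, k%:R^-1[] for every [w], hence the
   modification on a null set. *)
pose V (w : R) : R := if w \in `]0, k%:R^-1[ then w else k%:R^-1 / 2.
have mV : measurable_fun setT V.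
  apply: measurable_fun_ifT => //; apply: (measurable_fun_bool true).
  by rewrite setTI; exact: measurable_itv.
pose s := RandomChoice P (fun w => traps k (V w)).
have mV' : @measurable_fun _ _ (sample s) R setT V by exact: mV.
pose U : {RV law s >-> R} := HB.pack V (isMeasurableFun.Build _ _ (sample s) R V mV').
exists s, U; split => //=; last first.
  move=> w; rewrite /V; case: ifPn => //= _.
  by rewrite in_itv/=; apply/andP; split; lra.
move=> A mA; rewrite /distribution /pushforward/=.
have mVA : measurable (V @^-1` A).
  by rewrite -[X in measurable X]setTI; exact: mV.
rewrite !uniform_prob_restrict//; congr (_ * _)%E.
(* Dropping the endpoints leaves the open interval, where [V] is the identity. *)
rewrite -!lebesgue_measure_setI_itvoo//; congr (lebesgue_measure _).
by apply/seteqP; split => x [/= Ax x0k]; split => //; move: Ax; rewrite /V x0k.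
Qed.

End Defender.

(** * The attacker's random piece *)

Section Attacker.
Context {R : realType}.

(** Choosing a trap in each hit piece is injective because the pieces are disjoint, so at most [k]
    pieces are hit. *)
Lemma traps_miss (T : choiceType) (n k : nat) (I : 'I_n -> set T) (B : set T) :
  trivIset setT I -> (B #= `I_k)%card ->
  (n - k <= #|[set i | `[< I i `&` B = set0 >]]%SET|)%N.
Proof.
move=> tI /card_set_bijP [f [fB finj _]].
set G := [set i | _]%SET.
rewrite leq_subLR -[X in (X <= _)%N](card_ord n) -(cardsC G) addnC leq_add2r.
have hit (i : 'I_n) : i \in ~: G -> I i `&` B !=set0.
  by rewrite !inE => /asboolPn /eqP /set0P.
(* A hit piece supplies the default point for [xget] and shows that ['I_k] is inhabited. *)
have [->|/set0Pn[i0 i0G]] := eqVneq (~: G)%SET finset.set0.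
  by rewrite cards0.
have [x0 [_ Bx0]] := hit _ i0G.
have k0 : (0 < k)%N by apply: leq_ltn_trans (fB x0 Bx0).
pose b i := xget x0 (I i `&` B).
have bP i : i \in ~: G -> I i (b i) /\ B (b i).
  by move=> /hit [y yIB]; exact: (xgetI x0 yIB).
(* On hit pieces [f (b i) < k], so the default of [insubd] is never taken there. *)
pose g i : 'I_k := insubd (Ordinal k0) (f (b i)).
have ginj : {in ~: G &, injective g}.
  move=> i j iG jG gij; have [[Ii Bi] [Ij Bj]] := (bP i iG, bP j jG).
  have fij : f (b i) = f (b j).
    by move/(congr1 val): gij; rewrite !val_insubd !fB.
  have bij : b i = b j by apply: finj; rewrite ?inE.
  by apply: tI => //; exists (b i); split => //; rewrite bij.
by rewrite -(card_in_imset ginj) -[X in (_ <= X)%N](card_ord k) max_card.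
Qed.

Section EqualSubintervals.
Context {n : nat} (I : 'I_n -> set R) (eI : equal_subintervals I).

Lemma equal_subintervals_attacker_pure i : attacker_pure (I i).
Proof.
case: eI => iI _ UI _; split; last by apply/connected_intervalP.
by rewrite -UI; exact: bigcup_sup.
Qed.

Section UniformChoice.
Context (s : random_choice R (set R)) (k : nat) (us : uniform_choice I s).

(** Escape is the disjoint union of the events [J = i] over the missed pieces, each of probability
    [1/n]. *)
Lemma uniform_choice_escape (B : set R) : (B #= `I_k)%card ->
  measurable [set w : sample s | draw w `&` B = set0] /\
  (((n - k)%:R / n%:R)%:E <= law s [set w | draw w `&` B = set0%classic])%E.
Proof.
case: us => J [mJ PJ sJ] Bk; case: (eI) => _ tI _ _.
set G := [set i | `[< I i `&` B = set0 >]]%SET.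
have E : [set w : sample s | draw w `&` B = set0] =
    \bigcup_(i in [set` G]) J @^-1` [set i].
  apply/seteqP; split => [w /=|w [i /= iG Jw]].
    by rewrite sJ => h; exists (J w) => //=; rewrite inE; apply/asboolP.
  by move: iG; rewrite sJ Jw inE => /asboolP.
rewrite E; split; first by apply: fin_bigcup_measurable.
rewrite bigcup_pred measure_bigsetU_ord_cond//; last first.
  by move=> i j _ _ [w [/= <- <-]].
rewrite (eq_bigr (fun=> (n%:R^-1)%:E)); last by move=> i _; exact: PJ.
rewrite sumEFin lee_fin big_const iter_addr_0 -[X in _ <= X]mulr_natl.
by rewrite ler_wpM2r// ler_nat traps_miss.
Qed.

Lemma uniform_choice_guarantees : (0 < k)%N -> n = (2 * k)%N ->
  attacker_guarantees k s (4 * k%:R)^-1.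
Proof.
move=> k0 n2k; case: (us) => J [_ _ sJ]; case: (eI) => _ _ _ muI.
have muS (w : sample s) : lebesgue_measure (draw w) = (n%:R^-1)%:E by rewrite sJ muI.
split; first split => [w|B [_ Bk]].
- by rewrite sJ; exact: equal_subintervals_attacker_pure.
- have [mE _] := uniform_choice_escape Bk.
  exact: (measurable_payoff (B := fun=> B) muS).
- move=> B [_ Bk]; have [mE PE] := uniform_choice_escape Bk.
  rewrite (integral_payoff (B := fun=> B) _ muS)//.
  apply: le_trans (lee_wpmul2l _ PE); last by rewrite lee_fin.
  have kR : k%:R != 0 :> R by rewrite pnatr_eq0 -lt0n.
  (* Here [n - k = k]: escape has probability at least [1/2], and a piece is worth [1/(2k)]. *)
  rewrite -EFinM lee_fin n2k mul2n -addnn addnK addnn -mul2n natrM.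
  by rewrite le_eqVlt; apply/orP; left; apply/eqP; field.
Qed.

End UniformChoice.

Lemma exists_uniform_choice : (0 < n)%N ->
  exists s : random_choice R (set R), uniform_choice I s.
Proof.
move=> n0; case: eI => iI tI UI muI.
(* The index of the piece containing a uniform point of [[0, 1]] is a uniform
   index. *)
pose J (w : R) : 'I_n := xget (Ordinal n0) [set i | I i w].
have mI i : measurable (I i) by exact: is_interval_measurable.
have JI i w : I i w -> J w = i.
  move=> Iw; apply: tI => //; exists w; split => //.
  exact: (@xgetI _ (Ordinal n0) [set j | I j w] i Iw).
have I01 i : I i `<=` `[0, 1] by rewrite -UI; exact: bigcup_sup.
have J0 w : ~ `[0, 1]%classic w -> J w = Ordinal n0.
  by move=> w01; rewrite /J xgetPN// => i /I01.
have JE i : J @^-1` [set i] `&` `[0, 1] = I i.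
  apply/seteqP; split => [w [/= <- w01]|w Iw].
    have [j _ Iw] : (\bigcup_j I j) w by rewrite UI.
    by rewrite (JI _ _ Iw).
  by split; [exact: JI | exact: I01 Iw].
(* Outside [[0, 1]] the default index is taken; this null part enters only the measurability of
   [J]. *)
have JCE i : J @^-1` [set i] `&` ~` `[0, 1] =
    if i == Ordinal n0 then ~` `[0, 1]%classic else set0.
  case: eqP => [->|i0].
    by apply/seteqP; split => [w []//|w w01]; split => //; exact: J0.
  by apply/seteqP; split => // w [/= Ji /J0 Jw]; case: i0; rewrite -Ji Jw.
have mJ i : measurable (J @^-1` [set i]).
  rewrite -[X in measurable X]setIT -(setUv (`[0, 1]%classic : set R)) setIUr.
  rewrite JE JCE; apply: measurableU => //; case: ifP => // _.
  exact: measurableC.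
pose P : probability _ R := uniform_prob (@ltr01 R).
exists (RandomChoice P (fun w => I (J w))), J; split => //= i.
by rewrite uniform_prob_restrict// JE muI invr1 mul1e.
Qed.

End EqualSubintervals.

Lemma exists_equal_subintervals n : (0 < n)%N ->
  exists I : 'I_n -> set R, equal_subintervals I.
Proof.
move=> n0; have nR := invk_gt0 R n0.
(* Half-open on the left, except that the first interval contains [0]. *)
pose I (i : 'I_n) : set R :=
  [set` Interval (BSide (i == 0 :> nat) (i%:R / n%:R)) (BRight (i.+1%:R / n%:R))].
have I_le (i : 'I_n) x : I i x -> i%:R / n%:R <= x <= i.+1%:R / n%:R.
  rewrite /I /= itv_boundlr /= !bnd_simp => /andP[h ->]; rewrite andbT.
  by move: h; case: eqP => _; rewrite bnd_simp// => /ltW.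
have I_lt (i : 'I_n) x : (0 < i)%N -> I i x -> i%:R / n%:R < x.
  by rewrite /I /= itv_boundlr /= lt0n => /negPf -> /andP[]; rewrite bnd_simp.
exists I; split.
- by move=> i; exact: interval_is_interval.
(* For [i < j], points of [I i] are at most [(i+1)/n <= j/n], while those of [I j] exceed [j/n]
   strictly since [j > 0]. *)
- suff h (i j : 'I_n) x : (i < j)%N -> I i x -> ~ I j x.
    move=> i j _ _ [x [Ii Ij]]; apply/val_inj/eqP.
    by case: ltngtP => // ij; [have := h _ _ _ ij Ii | have := h _ _ _ ij Ij].
  move=> ij /I_le /andP[_ xi] /(I_lt _ _ (leq_ltn_trans (leq0n _) ij)).
  rewrite ltNge (le_trans xi)// ler_pM2r// ler_nat//.
- apply/seteqP; split => [x [i _ /I_le /andP[ix xi]]|x /=].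
    rewrite /= in_itv/=; apply/andP; split.
      by apply: le_trans ix; exact: divr_ge0.
    by apply: (le_trans xi); rewrite ler_pdivrMr ?ltr0n// mul1r ler_nat.
  rewrite in_itv/= => /andP[x0 x1].
  (* The piece containing [x] is the one with the least [m] such that [x <= (m+1)/n]; [n - 1] is a
     candidate since [x <= 1]. *)
  have ex : exists m, x <= m.+1%:R / n%:R.
    by exists n.-1; rewrite prednK// divff// pnatr_eq0 -lt0n.
  have [m xm minm] := ex_minnP ex.
  have mn : (m < n)%N.
    rewrite -(prednK n0) ltnS minm// prednK// divff// pnatr_eq0 -lt0n//.
  exists (Ordinal mn) => //; rewrite /I /= itv_boundlr /= !bnd_simp xm andbT.
  (* Index [0] includes its left endpoint; for a later index, minimality gives the strict left
     inequality. *)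
  case: m xm minm mn => [|m] xm minm mn /=; first by rewrite mul0r bnd_simp.
  by rewrite bnd_simp ltNge; apply/negP => /minm; rewrite ltnn.
- move=> i; rewrite /I lebesgue_measure_itv /= lte_fin ltr_pM2r// ltr_nat ltnSn.
  by rewrite -EFinD -mulrBl -natrB// subSnn mul1r.
Qed.

End Attacker.

(** * The value of the game and optimality *)

Lemma value_of_guarantees (R : realType) k (V : R) sa sd :
  attacker_guarantees k sa V -> defender_guarantees k sd V -> game_value k V.
Proof.
move=> [ma ga] [md gd] eps e0; split; [exists sa | exists sd].
- by split => // B pB; apply: le_trans (ga B pB); rewrite lee_fin; lra.
- by split => // S pS; apply: le_trans (gd S pS) _; rewrite lee_fin; lra.
Qed.

Theorem corollary3 (R : realType) (k : nat) (hk : (0 < k)%N) :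
  [/\ exists I : 'I_(2 * k) -> set R, equal_subintervals I,
      forall I : 'I_(2 * k) -> set R, equal_subintervals I ->
        (exists s, uniform_choice I s) /\
        (forall s, uniform_choice I s -> attacker_optimal k s),
      (exists s : random_choice R (set R), uniform_traps hk s) /\
      (forall s : random_choice R (set R),
         uniform_traps hk s -> defender_optimal k s) &
      game_value k ((4 * k%:R)^-1 : R)].
Proof.
have k2 : (0 < 2 * k)%N by rewrite muln_gt0.
have [I eI] := @exists_equal_subintervals R _ k2.
have [sa usa] := exists_uniform_choice eI k2.
have [sd usd] := @exists_uniform_traps R k hk.
(* One concrete strategy for each player fixes the value; every other strategy of these two forms
   guarantees the same number. *)
have ga := uniform_choice_guarantees eI usa hk erefl.
have gd := uniform_traps_guarantees usd.
have val := value_of_guarantees ga gd.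
split => //; first by exists I.
- move=> I' eI'; split; first exact: exists_uniform_choice.
  move=> s us; exists (4 * k%:R)^-1 => //.
  exact: (uniform_choice_guarantees eI' us hk erefl).
- split; first by exists sd.
  by move=> s us; exists (4 * k%:R)^-1 => //; exact: uniform_traps_guarantees us.
Qed.
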